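(* Let $E,F:\mathcal I\to\mathbb R^{m\times m}$ be sufficiently smooth and suppose that the DAE $E(t)x'(t)+F(t)x(t)=q(t)$, $t\in\mathcal I$, is regular on $\mathcal I$ with index $\mu$ and characteristics $r=r_0>r_1>\cdots>r_{\mu-1}$, or, equivalently, $r$ and $\theta_0\ge\cdots\ge\theta_{\mu-2}>\theta_{\mu-1}=0$. Then $S_{can}(t)$ has dimension $$d=r-\sum_{j=0}^{\mu-2}\theta_j=r_{\mu-1}\quad\text{for all } t\in\mathcal I,$$ and the matrix function $C:\mathcal I\to\mathbb R^{m\times d}$, $C=C_0C_1\cdots C_{\mu-1}$, generated by the reduction procedure is a basis of $S_{can}$.
   Context: $\mathcal I\subseteq\mathbb R$ is an interval; $E,F:\mathcal I\to\mathbb R^{m\times m}$ are sufficiently smooth matrix functions (as many continuous derivatives as the constructions require); $^*$ denotes transposition; solutions are continuously differentiable. A basis of a time-varying subspace is a matrix function whose columns at each $t$ form a basis of the subspace (matrices with zero columns are allowed). Relations between matrix functions are meant pointwise. Pre-regularity: A pair $\{E,F\}$ of $m\times m$ matrix functions is pre-regular on $\mathcal I$ if, with $N(t)=\ker E(t)$ and $S(t)=\{z\in\mathbb R^m: F(t)z\in\operatorname{im}E(t)\}$, one has $\operatorname{im}[E(t)\ F(t)]=\mathbb R^m$, $\operatorname{rank}E(t)=r$, $\dim (N(t)\cap S(t))=\theta$ for all $t\in\mathcal I$, with constant integers $r$, $\theta$. Reduction procedure: Set $E_0=E$, $F_0=F$, $m_0=m$. If $\{E_i,F_i\}$ (of size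 $m_i\times m_i$) is pre-regular with constants $r_i,\theta_i$, choose bases $Y_i:\mathcal I\to\mathbb R^{m_i\times r_i}$ of $\operatorname{im}E_i$, $Z_i:\mathcal I\to\mathbb R^{m_i\times(m_i-r_i)}$ of $(\operatorname{im}E_i)^\perp$ and a continuously differentiable basis $C_i:\mathcal I\to\mathbb R^{m_i\times r_i}$ of $S_i=\ker Z_i^*F_i$, and put $m_{i+1}=r_i$, $E_{i+1}=Y_i^*E_iC_i$, $F_{i+1}=Y_i^*(F_iC_i+E_iC_i')$. Then $\operatorname{rank}E_{i+1}=r_{i+1}=r_i-\theta_i$. Regularity: A pre-regular pair $\{E,F\}$ with $r=r_0<m$, and the DAE $Ex'+Fx=q$, are called regular with index $\mu\in\mathbb N$, $\mu\geq 1$, if the pairs $\{E_i,F_i\}$, $i=0,\dots,\mu-1$, are well defined and pre-regular, $r_0>r_1>\cdots>r_{\mu-1}$, and either $r_{\mu-1}>0$ and $E_\mu$ is pointwise nonsingular (so $r_\mu=r_{\mu-1}$), or $r_{\mu-1}=0$ (then $r_\mu:=r_{\mu-1}$). The characteristics are the ranks $r_0>\cdots>r_{\mu-1}=r_\mu$ or, equivalently, $r$ and $\theta_0\ge\theta_1\ge\cdots\ge\theta_{\mu-2}>\theta_{\mu-1}=0$; they do not depend on the chosen bases. Canonical flow subspace: for $\bar t\in\mathcal I$, $S_{can}(\bar t)$ is the set of all $\bar x\in\mathbb R^m$ for which there is a solution $x:(\bar t-\delta,\bar t+\delta)\cap\mathcal I\to\mathbb R^m$ (some $\delta>0$) of the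 homogeneous DAE $Ex'+Fx=0$ with $x(\bar t)=\bar x$. *)

(* Defs.v *)
From HB Require Import structures.
From mathcomp Require Import all_boot all_order all_algebra.
From mathcomp Require Import all_classical all_reals all_analysis.
Import Order.TTheory GRing.Theory Num.Theory.
Import numFieldNormedType.Exports.

Set Implicit Arguments.
Unset Strict Implicit.
Unset Printing Implicit Defensive.

Local Open Scope classical_set_scope.
Local Open Scope ring_scope.

(* Matrix functions on an interval I are total functions R -> 'M[R]_(m, n);
   every notion below only looks at their values on I. *)

Section calculus.
Context {R : realType} {V : normedModType R}.
Implicit Types (I : set R) (f : R -> V).

Definition diff_quot f (t : R) : R -> V := fun s => (s - t)^-1 *: (f s - f t).

(* Derivative relative to I: one-sided at an endpoint that belongs to I. *)
Definition deriv_on I f (t : R) : V := lim (diff_quot f t @ within I t^').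

Definition C1_on I f : Prop :=
  (forall t, I t -> cvg (diff_quot f t @ within I t^')) /\
  {within I, continuous (deriv_on I f)}.

End calculus.

Section subspaces.
Context {R : realType}.

Definition mxim m n (A : 'M[R]_(m, n)) : set 'cV[R]_m :=
  [set A *m z | z in [set: 'cV[R]_n]].

Definition mxker m n (A : 'M[R]_(m, n)) : set 'cV[R]_n := [set z | A *m z = 0].

Definition orthcompl m (U : set 'cV[R]_m) : set 'cV[R]_m :=
  [set z | forall y, U y -> y^T *m z = 0].

Definition has_dim m (U : set 'cV[R]_m) (d : nat) : Prop :=
  exists V : {vspace 'cV[R]_m}, U = [set` V] /\ \dim V = d.

Definition is_basis m d (U : set 'cV[R]_m) (B : 'M[R]_(m, d)) : Prop :=
  exists V : {vspace 'cV[R]_m},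
    U = [set` V] /\ basis_of V [seq col j B | j <- enum 'I_d].

End subspaces.

Section dae.
Context {R : realType}.
Implicit Type I : set R.

(* The subspace S(t) attached to the values E = E(t) and F = F(t). *)
Definition Ssub m (E F : 'M[R]_m) : set 'cV[R]_m :=
  [set z | mxim E (F *m z)].

Definition pre_regular I m (E F : R -> 'M[R]_m) (r theta : nat) : Prop :=
  forall t, I t ->
    [/\ mxim (row_mx (E t) (F t)) = setT,
        \rank (E t) = r
      & has_dim (mxker (E t) `&` Ssub (E t) (F t)) theta].

(* Size m_i of the i-th pair: m_0 = m and m_{i+1} = r_i. *)
Definition rsize (m : nat) (r : nat -> nat) (i : nat) : nat :=
  if i is j.+1 then r j else m.

(* Candidates for the Y_i, Z_i, C_i; only finitely many indices i are ever
   constrained. *)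
Record red_data (m : nat) (r : nat -> nat) := RedData {
  redY : forall i, R -> 'M[R]_(rsize m r i, r i);
  redZ : forall i, R -> 'M[R]_(rsize m r i, rsize m r i - r i);
  redC : forall i, R -> 'M[R]_(rsize m r i, r i) }.

Section reduction.
Variables (I : set R) (m : nat) (E F : R -> 'M[R]_m) (r : nat -> nat).
Variable B : red_data m r.

Fixpoint red_pair (i : nat) :
    (R -> 'M[R]_(rsize m r i)) * (R -> 'M[R]_(rsize m r i)) :=
  match i with
  | 0 => (E, F)
  | j.+1 =>
    let: (Ej, Fj) := red_pair j in
    (fun t => (redY B j t)^T *m Ej t *m redC B j t,
     fun t => (redY B j t)^T *m
       (Fj t *m redC B j t + Ej t *m deriv_on I (redC B j) t))
  end.

Definition redE i := (red_pair i).1.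
Definition redF i := (red_pair i).2.

(* The Y_i, Z_i, C_i with i < mu are admissible choices in mu steps of the
   reduction procedure. *)
Definition red_admissible (mu : nat) : Prop :=
  forall i, (i < mu)%N ->
    [/\ forall t, I t -> is_basis (mxim (redE i t)) (redY B i t),
        forall t, I t -> is_basis (orthcompl (mxim (redE i t))) (redZ B i t),
        forall t, I t ->
          is_basis (mxker ((redZ B i t)^T *m redF i t)) (redC B i t)
      & C1_on I (redC B i)].

(* C_0 C_1 ... C_{i-1}; for i > 0 the number rsize m r i of columns is r_{i-1}. *)
Fixpoint redCprod (i : nat) : R -> 'M[R]_(m, rsize m r i) :=
  match i with
  | 0 => fun=> 1%:M
  | j.+1 => fun t => redCprod j t *m redC B j t
  end.

End reduction.

(* {E, F} is regular on I with index mu and characteristics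
   r_0 > ... > r_{mu-1}, equivalently r_0 and theta_0, ..., theta_{mu-1};
   the values of r and theta at indices >= mu are irrelevant. *)
Definition regular I m (E F : R -> 'M[R]_m) (mu : nat) (r theta : nat -> nat)
    : Prop :=
  [/\ (0 < mu)%N, (r 0 < m)%N,
      forall i, (i.+1 < mu)%N -> (r i.+1 < r i)%N
    & exists B : red_data m r,
      [/\ red_admissible I E F B mu,
          forall i, (i < mu)%N ->
            pre_regular I (redE I E F B i) (redF I E F B i) (r i) (theta i)
        & ((0 < r mu.-1)%N /\ forall t, I t -> redE I E F B mu t \in unitmx)
          \/ r mu.-1 = 0%N]].

Definition dae_solution (J : set R) m (E F : R -> 'M[R]_m) (x : R -> 'cV[R]_m)
    : Prop :=
  C1_on J x /\ forall s, J s -> E s *m deriv_on J x s + F s *m x s = 0.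

Definition Scan I m (E F : R -> 'M[R]_m) (t : R) : set 'cV[R]_m :=
  [set z | exists delta : R, 0 < delta /\
     exists x : R -> 'cV[R]_m,
       dae_solution (`]t - delta, t + delta[ `&` I) E F x /\ x t = z].

End dae.

(* Main.v *)
Require Import Defs.
From HB Require Import structures.
From mathcomp Require Import all_boot all_order all_algebra.
From mathcomp Require Import all_classical all_reals all_analysis.
From mathcomp Require Import lra ring.
Import Order.TTheory GRing.Theory Num.Theory.
Import numFieldNormedType.Exports.

Set Implicit Arguments.
Unset Strict Implicit.
Unset Printing Implicit Defensive.

Local Open Scope classical_set_scope.
Local Open Scope ring_scope.

(**
  Put [P = C_0 C_1 ... C_{i-1}].  Composing the pseudo-inverses of the [Y_j^*]
  gives an injective [G] with [G E_i = E P] and [G F_i = F P + E P'], because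
  [E_j C_j] and [F_j C_j + E_j C_j'] have their image in [im E_j].  Hence
  inserting [x = P u] in [E x' + F x = 0] is equivalent to [E_i u' + F_i u = 0],
  and [im (P C_i) = {P u | (F P + E P') u in im (E P)}]; this description does
  not involve the [Y_j] and is unchanged when [P] is replaced by [P H] with [H]
  continuously differentiable, so [im P] does not depend on the choices made.
  By induction every solution takes its values in [im P], for [i = mu] included.
  Conversely, for [i = mu] the matrix [E P] has full column rank and
  [F P + E P'] has its image in [im (E P)], so that solutions [x = P u] are those
  of the linear ODE [u' = - (E P)^+ (F P + E P') u], whose coefficient is
  continuous on [I] even though the [Y_j], hence [E_mu] and [F_mu], need not be.
  Local solvability of this ODE follows from a fixed-point argument; uniqueness
  is not needed.
*)

(** * Linear algebra *)

(* Locked because rewriting with [mulmxA] would otherwise unfold it. *)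
HB.lock Definition ginv (R : comUnitRingType) m n (B : 'M[R]_(m, n)) : 'M[R]_(n, m) :=
  invmx (B^T *m B) *m B^T.

Lemma unitmx_size0 (R : comUnitRingType) n (A : 'M[R]_n) : n = 0%N -> A \in unitmx.
Proof. by move=> n0; subst n; rewrite unitmxE det_mx00 unitr1. Qed.

(** Read [D] and [H'] as the derivatives of [P] and [H]. The part [e *m P *m H'] of the product rule
    for [P *m H] moves to the left, which leaves a membership in the image of [e *m P]. *)
Lemma substitute_factor (R : nzRingType) n p q k (e f : 'M[R]_n)
    (P D : 'M[R]_(n, p)) (H H' : 'M[R]_(p, q)) (w z : 'M[R]_(q, k)) :
  e *m (P *m H) *m w = (f *m (P *m H) + e *m (D *m H + P *m H')) *m z ->
  e *m P *m (H *m w - H' *m z) = (f *m P + e *m D) *m (H *m z).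
Proof.
rewrite mulmxBr !(mulmxDl, mulmxDr) !mulmxA => ->.
by rewrite addrA addrK.
Qed.

Section linear_algebra.
Context {R : realType}.

(** For matrices acting on columns, [row_full] means full column rank, so a left inverse exists. *)
Lemma row_full_inj m n (B : 'M[R]_(m, n)) (p : nat) (z w : 'M[R]_(n, p)) :
  row_full B -> B *m z = B *m w -> z = w.
Proof.
by move=> /row_fullP[L LB] /(congr1 (mulmx L)); rewrite !mulmxA LB !mul1mx.
Qed.

(** The columns of [cokermx B] are annihilated by [B], hence zero, and the rank of [cokermx B] is
    [n - \rank B]. *)
Lemma inj_row_full m n (B : 'M[R]_(m, n)) :
  (forall z : 'cV[R]_n, B *m z = 0 -> z = 0) -> row_full B.
Proof.
move=> injB; have K0 : cokermx B = 0.
  apply/matrixP => i j; have := injB (cokermx B *m delta_mx j 0).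
  rewrite mulmxA mulmx_coker mul0mx => /(_ erefl)/colP/(_ i).
  by rewrite -colE !mxE.
have := mxrank_coker B; rewrite K0 mxrank0 => /esym/eqP.
by rewrite subn_eq0 /row_full eqn_leq rank_leq_col.
Qed.

Lemma row_full_mul m n p (A : 'M[R]_(m, n)) (B : 'M[R]_(n, p)) :
  row_full A -> row_full B -> row_full (A *m B).
Proof.
move=> /row_fullP[K KA] /row_fullP[L LB]; apply/row_fullP.
by exists (L *m K); rewrite mulmxA -(mulmxA L) KA mulmx1.
Qed.

Lemma mxim_mull m n p (A : 'M[R]_(m, n)) (B : 'M[R]_(n, p)) :
  mxim (A *m B) `<=` mxim A.
Proof. by move=> _ [z _ <-]; exists (B *m z) => //; rewrite mulmxA. Qed.

Lemma mulmx_sum_col m n (A : 'M[R]_(m, n)) (z : 'cV[R]_n) :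
  A *m z = \sum_j z j 0 *: col j A.
Proof.
apply/colP => i; rewrite !mxE summxE; apply: eq_bigr => j _.
by rewrite !mxE mulrC.
Qed.

(** Since [B *m z] combines the columns of [B] with coefficients [z], spanning becomes equality with
    the image and freeness becomes injectivity. *)
Lemma is_basisP m d (U : set 'cV[R]_m) (B : 'M[R]_(m, d)) :
  is_basis U B <-> U = mxim B /\ row_full B.
Proof.
have [X XE Xi] : exists2 X : d.-tuple 'cV[R]_m,
    [seq col j B | j <- enum 'I_d] = X & forall i : 'I_d, X`_i = col i B.
  exists [tuple col j B | j < d]; first by rewrite -val_ord_tuple.
  by move=> i; rewrite -tnth_nth tnth_mktuple.
have spanE : [set` <<X>>%VS] = mxim B.
  apply/seteqP; split => [v /= /(@coord_span _ _ _ X) vE|_ [z _ <-]] /=.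
    exists (\col_j coord X j v) => //.
    rewrite mulmx_sum_col; apply: etrans (esym vE); apply: eq_bigr => j _.
    by rewrite !mxE Xi.
  rewrite mulmx_sum_col; apply: rpred_sum => j _; apply: rpredZ.
  by rewrite -Xi memv_span// mem_nth// size_tuple.
split=> [[V [-> ]]|[-> fB]].
  rewrite XE => /andP[/eqP <- /freeP fX]; split; first by rewrite spanE.
  apply: inj_row_full => z Bz; apply/colP => j; rewrite mxE.
  apply: (fX (fun j => z j 0)); apply: etrans Bz; rewrite mulmx_sum_col.
  by apply: eq_bigr => i _; rewrite Xi.
exists <<X>>%VS; split; first by rewrite spanE.
rewrite XE; apply/andP; split => //; apply/freeP => k k0 i.
suff /colP/(_ i) : \col_i k i = 0 :> 'cV[R]_d by rewrite !mxE.
apply: (row_full_inj fB); rewrite mulmx0; apply: etrans k0; rewrite mulmx_sum_col.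
by apply: eq_bigr => j _; rewrite !mxE Xi.
Qed.

Lemma is_basis_has_dim m d (U : set 'cV[R]_m) (B : 'M[R]_(m, d)) :
  is_basis U B -> has_dim U d.
Proof.
move=> [V [UV BV]]; exists V; split => //.
have /= -> := size_basis (BV : basis_of V (in_tuple _)).
by rewrite size_map size_enum_ord.
Qed.

Lemma has_dim_basis m d (U : set 'cV[R]_m) :
  has_dim U d -> exists B : 'M[R]_(m, d), is_basis U B.
Proof.
move=> [V [-> <-]]; exists (\matrix_(i, j) (vbasis V)`_j i 0).
exists V; split => //; suff -> : [seq col j (\matrix_(i, j) (vbasis V)`_j i 0)
    | j <- enum 'I_(\dim V)] = vbasis V by exact: vbasisP.
apply: (@eq_from_nth _ 0); first by rewrite size_map size_enum_ord size_tuple.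
move=> k; rewrite size_map size_enum_ord => kV.
rewrite (nth_map (Ordinal kV)) ?size_enum_ord//.
by apply/colP => i; rewrite !mxE (nth_enum_ord (Ordinal kV) kV).
Qed.

Lemma trmx_mul_self_eq0 n p (z : 'M[R]_(n, p)) : (z^T *m z = 0) -> z = 0.
Proof.
move=> zz; apply/matrixP => i j; rewrite mxE.
have /matrixP/(_ j j) := zz; rewrite !mxE => /eqP.
rewrite psumr_eq0 => [/allP/(_ i)|k _]; last by rewrite mxE -expr2 sqr_ge0.
by rewrite mem_index_enum => /(_ isT) /=; rewrite mxE mulf_eq0 orbb => /eqP.
Qed.

Lemma gram_unit m n (B : 'M[R]_(m, n)) : row_full B -> B^T *m B \in unitmx.
Proof.
move=> fB; rewrite -row_full_unit; apply: inj_row_full => z BBz.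
apply: (row_full_inj fB); rewrite mulmx0; apply: trmx_mul_self_eq0.
by rewrite trmx_mul -mulmxA (mulmxA B^T) BBz mulmx0.
Qed.

Lemma ginvK m n (B : 'M[R]_(m, n)) : row_full B -> ginv B *m B = 1%:M.
Proof. by move=> fB; rewrite ginv.unlock -mulmxA mulVmx// gram_unit. Qed.

Lemma row_full_tr_ginv m n (B : 'M[R]_(m, n)) : row_full B -> row_full (ginv B)^T.
Proof.
move=> fB; apply/row_fullP; exists B^T.
by rewrite -trmx_mul ginvK// trmx1.
Qed.

(** The product [(ginv B)^T *m B^T] is the orthogonal projector onto the image of [B]. In the
    reduction this undoes the multiplication by [Y_i^*]. *)
Lemma tr_ginvK m n p (B : 'M[R]_(m, n)) (A : 'M[R]_(m, p)) : row_full B ->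
  mxim A `<=` mxim B -> (ginv B)^T *m (B^T *m A) = A.
Proof.
move=> fB AB; apply/matrixP => i j.
have [|w _ Bw] := AB (col j A).
  by exists (delta_mx j 0); rewrite // colE.
have : (ginv B)^T *m (B^T *m A) *m delta_mx j 0 = col j A.
  rewrite -!mulmxA -colE -Bw ginv.unlock trmx_mul trmxK trmx_inv trmx_mul trmxK.
  by rewrite -!mulmxA (mulmxA B^T) (mulmxA (invmx _)) mulVmx ?gram_unit// mul1mx.
by rewrite -colE => /colP/(_ i); rewrite !mxE.
Qed.

(** The product [P *m ginv P] is the orthogonal projector onto the image of [P]. Thus [ginv P *m x]
    gives coordinates of [x] with respect to [P], continuously differentiable whenever [P] and [x]
    are. *)
Lemma mxim_ginvK n p q (P : 'M[R]_(n, p)) (x : 'M[R]_(n, q)) : row_full P ->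
  mxim x `<=` mxim P -> P *m (ginv P *m x) = x.
Proof.
move=> fP xP; apply/matrixP => i j.
have [|v _ Pv] := xP (col j x); first by exists (delta_mx j 0); rewrite // colE.
have : P *m (ginv P *m x) *m delta_mx j (0 : 'I_1) = col j x.
  by rewrite -!mulmxA -colE -Pv (mulmxA (ginv P)) ginvK// mul1mx.
by rewrite -colE => /colP/(_ i); rewrite !mxE.
Qed.

(** In finite dimension, what is orthogonal to the orthogonal complement of the image of [E] lies in
    that image. *)
Lemma mxker_orthcompl m k (E F : 'M[R]_m) (Z : 'M[R]_(m, k)) :
  is_basis (orthcompl (mxim E)) Z -> mxker (Z^T *m F) = Ssub E F.
Proof.
move=> /is_basisP[ZE _]; apply/seteqP; split => z; rewrite /mxker/Ssub/mxim/=.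
- rewrite -mulmxA => ZFz; set w := F *m z in ZFz *.
  (* Membership in the image is tested with [cokermx E^T]: its columns are orthogonal to the image
     of [E], hence lie in the image of [Z]. *)
  suff /submxP[D wD] : (w^T <= E^T)%MS.
    by exists D^T => //; rewrite -[w]trmxK wD trmx_mul trmxK.
  rewrite submxE; apply/eqP/matrixP => i j; rewrite (ord1 i) [RHS]mxE.
  have [u _ uE] : mxim Z (col j (cokermx E^T)).
    rewrite -ZE => _ [v _ <-]; rewrite trmx_mul -mulmxA colE (mulmxA E^T).
    by rewrite mulmx_coker mul0mx mulmx0.
  have : (w^T *m cokermx E^T *m delta_mx j (0 : 'I_1)) 0 0 = 0.
    rewrite -mulmxA -colE -uE mulmxA -[Z]trmxK -trmx_mul ZFz trmx0 mul0mx.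
    by rewrite mxE.
  by rewrite -colE [LHS]mxE.
- move=> [v _ Ev]; rewrite -mulmxA -Ev mulmxA.
  suff -> : Z^T *m E = 0 by rewrite mul0mx.
  apply/matrixP => i j.
  have EZ : orthcompl (mxim E) (col i Z).
    by rewrite ZE; exists (delta_mx i 0) => //; rewrite colE.
  have /EZ/colP/(_ 0) : mxim E (col j E).
    by exists (delta_mx j 0) => //; rewrite colE.
  rewrite !mxE => EZ0; apply: etrans EZ0; apply: eq_bigr => l _.
  by rewrite !mxE mulrC.
Qed.

(** Rank-nullity: if [W] is a basis of the kernel, then [W^T] has the same row space as
    [kermx A^T]. *)
Lemma mxker_rank m n d (A : 'M[R]_(m, n)) :
  has_dim (mxker A) d -> (\rank A + d = n)%N.
Proof.
move=> /has_dim_basis[W /is_basisP[AW /eqP fW]].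
have KW : (kermx A^T :=: W^T)%MS.
  apply/eqmxP/andP; split; last first.
    apply/sub_kermxP/trmx_inj; rewrite trmx_mul !trmxK trmx0.
    apply/matrixP => i j; rewrite mxE.
    have : mxker A (col j W) by rewrite AW; exists (delta_mx j 0); rewrite // colE.
    by rewrite /mxker /= colE mulmxA -colE => /colP/(_ i); rewrite !mxE.
  apply/row_subP => i.
  have : mxker A (row i (kermx A^T))^T.
    rewrite /mxker/=; apply: trmx_inj; rewrite trmx_mul trmxK.
    by rewrite -row_mul mulmx_ker row0 trmx0.
  rewrite AW => -[v _ Wv]; apply/submxP; exists v^T.
  by rewrite -trmx_mul Wv trmxK.
have := mxrank_ker A^T; rewrite KW !mxrank_tr fW => ->.
by rewrite subnKC// rank_leq_col.
Qed.

(** As [Y^T] is injective on the image of [E], the matrix [C] maps the kernel of [Y^T *m E *m C]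
    isomorphically onto the intersection of [ker E] and [S]. Rank-nullity then gives
    [r_{i+1} = r_i - theta_i]. *)
Lemma rank_reduced_pair n r th (E F : 'M[R]_n) (Y C : 'M[R]_(n, r)) :
  is_basis (mxim E) Y -> is_basis (Ssub E F) C ->
  has_dim (mxker E `&` Ssub E F) th -> (\rank (Y^T *m E *m C) + th = r)%N.
Proof.
move=> /is_basisP[EY fY] /is_basisP[SC fC] /has_dim_basis[K /is_basisP[KE fK]].
have KC : mxim K `<=` mxim C by rewrite -KE SC; exact: subIsetr.
have CgK : C *m (ginv C *m K) = K by exact: mxim_ginvK.
(* The coordinates with respect to [C] of the basis [K] of the intersection form a basis of this
   kernel. *)
apply: mxker_rank; apply: (@is_basis_has_dim _ _ _ (ginv C *m K)).
apply/is_basisP; split; last first.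
  apply: inj_row_full => z /(congr1 (mulmx C)).
  by rewrite mulmxA CgK mulmx0 -(mulmx0 _ K) => /row_full_inj; exact.
apply/seteqP; split => [u|_ [v _ <-]]; rewrite /mxker/=.
  rewrite -!mulmxA => YECu.
  have ECu : E *m (C *m u) = 0.
    rewrite -(tr_ginvK (A := E *m (C *m u)) fY) ?YECu ?mulmx0//.
    by rewrite -EY; exact: mxim_mull.
  have : (mxker E `&` Ssub E F) (C *m u) by split => //; rewrite SC; exists u.
  rewrite KE => -[v _ Kv]; exists v => //.
  by apply: (row_full_inj fC); rewrite mulmxA CgK.
have [EKv _] : (mxker E `&` Ssub E F) (K *m v) by rewrite KE; exists v.
by rewrite -2!(mulmxA Y^T) -(mulmxA E) (mulmxA C) CgK EKv mulmx0.
Qed.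

End linear_algebra.

(** * Limits and derivatives of matrix functions *)

Section matrix_limits.
Context {R : realType} {T : Type} (F : set_system T) {FF : Filter F}.

Lemma cvg_mxP m n (f : T -> 'M[R]_(m, n)) (a : 'M[R]_(m, n)) :
  f @ F --> a <-> forall i j, (fun x => f x i j) @ F --> a i j.
Proof.
split=> [fa i j|fa].
  exact: (continuous_cvg FF (@coord_continuous R _ _ i j a) fa).
apply/cvgrPdist_le => e e0; near=> x.
rewrite /Num.Def.normr/= mx_normrE (bigmax_le _ (ltW e0))//= => -[i j] _ /=.
rewrite !mxE; move: i j; near: x.
apply: filter_forall => i; apply: filter_forall => j.
exact: (cvgrPdist_le _ _).1.
Unshelve. all: by end_near. Qed.

Lemma cvg_trmx m n (f : T -> 'M[R]_(m, n)) (a : 'M[R]_(m, n)) :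
  f @ F --> a -> (fun x => (f x)^T) @ F --> a^T.
Proof.
move=> /cvg_mxP fa; apply/cvg_mxP => i j; rewrite mxE.
by under eq_fun do rewrite mxE; exact: fa.
Qed.

Lemma cvg_mulmx m n p (f : T -> 'M[R]_(m, n)) (g : T -> 'M[R]_(n, p))
    (a : 'M[R]_(m, n)) (b : 'M[R]_(n, p)) :
  f @ F --> a -> g @ F --> b -> (fun x => f x *m g x) @ F --> a *m b.
Proof.
move=> /cvg_mxP fa /cvg_mxP gb; apply/cvg_mxP => i j; rewrite mxE.
under eq_fun do rewrite mxE.
apply: cvg_big => [|k _]; first exact: add_continuous.
exact: cvgM.
Qed.

Lemma cvg_det n (f : T -> 'M[R]_n) (a : 'M[R]_n) :
  f @ F --> a -> (fun x => \det (f x)) @ F --> \det a.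
Proof.
move=> /cvg_mxP fa; rewrite /determinant.
apply: cvg_big => [|s _]; first exact: add_continuous.
apply: cvgM; first exact: cvg_cst.
by apply: cvg_big => [|k _]; [exact: mul_continuous|exact: fa].
Qed.

Lemma cvg_adjmx n (f : T -> 'M[R]_n) (a : 'M[R]_n) :
  f @ F --> a -> (fun x => \adj (f x)) @ F --> \adj a.
Proof.
move=> fa; apply/cvg_mxP => i j; rewrite mxE.
under eq_fun do rewrite mxE.
apply: cvgM; first exact: cvg_cst.
apply: cvg_det; apply/cvg_mxP => k l; rewrite !mxE.
by under eq_fun do rewrite !mxE; apply: (cvg_mxP _ _).1 fa _ _.
Qed.

(** Cramer's formula is continuous. The total function [invmx] agrees with it where the determinant
    is nonzero, which holds eventually because the determinants converge to [\det a]. *)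
Lemma cvg_invmx n (f : T -> 'M[R]_n) (a : 'M[R]_n) : a \in unitmx ->
  f @ F --> a -> (fun x => invmx (f x)) @ F --> invmx a.
Proof.
move=> ua fa; have da := cvg_det fa.
have da0 : \det a != 0 by rewrite -unitfE -unitmxE.
suff : (fun x => (\det (f x))^-1 *: \adj (f x)) @ F --> (\det a)^-1 *: \adj a.
  rewrite [X in _ -> _ --> X]/invmx ua; apply: cvg_trans.
  apply: near_eq_cvg; near=> x; rewrite /invmx unitmxE unitfE ifT//.
  by near: x; exact: cvgr_neq0 da0.
apply: cvgZ; last exact: cvg_adjmx.
exact: cvgV.
Unshelve. all: by end_near. Qed.

End matrix_limits.

(** * Derivatives relative to a subset of the line *)

Section relative_derivative.
Context {R : realType}.
Implicit Types I : set R.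

(** Asserts convergence together with the value, whereas [deriv_on], being a [lim], is informative
    only once convergence is known. *)
Definition has_deriv {V : normedModType R} I (f : R -> V) (t : R) (l : V) : Prop :=
  diff_quot f t @ within I t^' --> l.

(** At an isolated point the filter [within I t^'] contains the empty set, so every value would be a
    limit of the difference quotient. *)
Definition no_isolated_point I := forall t, I t -> ProperFilter (within I t^').

Lemma deriv_onE {V : normedModType R} I (f : R -> V) t l : no_isolated_point I -> I t ->
  has_deriv I f t l -> deriv_on I f t = l.
Proof. by move=> aI It fl; have := aI t It => ?; exact: cvg_lim. Qed.

Lemma deriv_on_eq {V : normedModType R} I (f g : R -> V) t :
  {in I, f =1 g} -> I t -> deriv_on I f t = deriv_on I g t.
Proof.
move=> fg It; rewrite /deriv_on; congr (lim _).
have fg' : {in I, diff_quot f t =1 diff_quot g t}.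
  by move=> s Is; rewrite /diff_quot (fg s Is) (fg t (mem_set It)).
have gf' : {in I, diff_quot g t =1 diff_quot f t} by move=> s /fg'.
by apply/seteqP; split;
  [exact: fmap_within_eq (dnbhs_filter t) gf'|exact: fmap_within_eq (dnbhs_filter t) fg'].
Qed.

Lemma has_deriv_cvg {V : normedModType R} I (f : R -> V) t l :
  has_deriv I f t l -> f @ within I (nbhs t) --> f t.
Proof.
move=> fl.
have tt : (fun s => s - t) @ within I t^' --> (0 : R).
  rewrite -(subrr t); apply: cvgB; last exact: cvg_cst.
  by apply: cvg_trans (cvg_within _) _; exact: nbhs_dnbhs.
have /cvgrPdist_le ft : f @ within I t^' --> f t.
  apply: cvg_sub0; last exact: (cvg_cst (f t)).
  rewrite -(scale0r l); apply: cvg_trans (cvgZ tt fl).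
  apply: near_eq_cvg; rewrite near_withinE.
  near=> s => _; rewrite /diff_quot/= scalerA divff ?scale1r//.
  rewrite subr_eq0; near: s; exact: nbhs_dnbhs_neq.
apply/cvgrPdist_le => e e0; have := ft e e0.
rewrite !near_withinE; apply: filterS => s ts Is.
by have [->|/ts] := eqVneq s t; [rewrite subrr normr0 ltW|exact].
Unshelve. all: by end_near. Qed.

Lemma has_deriv_mul m n p I (f : R -> 'M[R]_(m, n)) (g : R -> 'M[R]_(n, p)) t
    (f' : 'M[R]_(m, n)) (g' : 'M[R]_(n, p)) :
  has_deriv I f t f' -> has_deriv I g t g' ->
  has_deriv I (fun s => f s *m g s) t (f' *m g t + f t *m g').
Proof.
move=> ff' gg'; have gt : g @ within I t^' --> g t.
  apply: cvg_trans (has_deriv_cvg gg'); apply: cvg_fmap2 => A.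
  by rewrite /within/= => /nbhs_dnbhs.
have ft : (fun=> f t) @ within I t^' --> f t by exact: cvg_cst.
apply: cvg_trans (cvgD (cvg_mulmx ff' gt) (cvg_mulmx ft gg')).
apply: near_eq_cvg; apply: nearW => s; rewrite /diff_quot/= !fctE.
rewrite -scalemxAl -scalemxAr -scalerDr mulmxBl mulmxBr addrA subrK.
by [].
Qed.

Lemma has_deriv_tr m n I (f : R -> 'M[R]_(m, n)) t (f' : 'M[R]_(m, n)) :
  has_deriv I f t f' -> has_deriv I (fun s => (f s)^T) t f'^T.
Proof.
move=> /cvg_trmx; apply: cvg_trans; apply: near_eq_cvg; apply: nearW => s.
by rewrite /diff_quot/= linearZ linearB.
Qed.

(** Rests on the identity [f(s)^-1 - f(t)^-1 = - f(s)^-1 (f(s) - f(t)) f(t)^-1]. *)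
Lemma has_deriv_inv n I (f : R -> 'M[R]_n) t (f' : 'M[R]_n) :
  (forall s, I s -> f s \in unitmx) -> I t -> has_deriv I f t f' ->
  has_deriv I (fun s => invmx (f s)) t (- (invmx (f t) *m f' *m invmx (f t))).
Proof.
move=> uf It ff'; have ft : f @ within I t^' --> f t.
  apply: cvg_trans (has_deriv_cvg ff'); apply: cvg_fmap2 => A.
  by rewrite /within/= => /nbhs_dnbhs.
have ct : (fun=> invmx (f t)) @ within I t^' --> invmx (f t) by exact: cvg_cst.
apply: cvg_trans (cvgN (cvg_mulmx (cvg_mulmx (cvg_invmx (uf t It) ft) ff') ct)).
apply: near_eq_cvg; rewrite near_withinE; apply: nearW => s Is.
rewrite /diff_quot/= !fctE -scalemxAr -scalemxAl -scalerN mulmxBr mulmxBl.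
by rewrite mulVmx ?uf// mul1mx -mulmxA mulmxV ?uf// mulmx1 opprB.
Qed.

Lemma C1_has_deriv {V : normedModType R} I (f : R -> V) t : C1_on I f -> I t ->
  has_deriv I f t (deriv_on I f t).
Proof. by move=> [+ _] It => /(_ t It). Qed.

Lemma has_deriv_C1 {V : normedModType R} I (f f' : R -> V) : no_isolated_point I ->
  (forall t, I t -> has_deriv I f t (f' t)) -> {within I, continuous f'} ->
  C1_on I f.
Proof.
move=> aI ff' cf'; split=> [t It|]; first by apply/cvg_ex; exists (f' t); exact: ff'.
apply: subspace_eq_continuous cf' => t; rewrite inE => It.
by apply/esym; exact: deriv_onE (ff' t It).
Qed.

Lemma C1_continuous {V : normedModType R} I (f : R -> V) :
  C1_on I f -> {within I, continuous f}.
Proof.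
by move=> cf; apply/subspace_continuousP => t It; exact: has_deriv_cvg (C1_has_deriv cf It).
Qed.

Lemma within_mulmx m n p I (f : R -> 'M[R]_(m, n)) (g : R -> 'M[R]_(n, p)) :
  {within I, continuous f} -> {within I, continuous g} ->
  {within I, continuous (fun t => f t *m g t)}.
Proof.
move=> /subspace_continuousP cf /subspace_continuousP cg.
by apply/subspace_continuousP => t It; apply: cvg_mulmx; [exact: cf|exact: cg].
Qed.

Lemma within_trmx m n I (f : R -> 'M[R]_(m, n)) :
  {within I, continuous f} -> {within I, continuous (fun t => (f t)^T)}.
Proof.
move=> /subspace_continuousP cf.
by apply/subspace_continuousP => t It; apply: cvg_trmx; exact: cf.
Qed.

Lemma within_addmx m n I (f g : R -> 'M[R]_(m, n)) :
  {within I, continuous f} -> {within I, continuous g} ->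
  {within I, continuous (fun t => f t + g t)}.
Proof.
move=> /subspace_continuousP cf /subspace_continuousP cg.
by apply/subspace_continuousP => t It; apply: cvgD; [exact: cf|exact: cg].
Qed.

Lemma within_oppmx m n I (f : R -> 'M[R]_(m, n)) :
  {within I, continuous f} -> {within I, continuous (fun t => - f t)}.
Proof.
move=> /subspace_continuousP cf.
by apply/subspace_continuousP => t It; apply: cvgN; exact: cf.
Qed.

Lemma within_invmx n I (f : R -> 'M[R]_n) : (forall t, I t -> f t \in unitmx) ->
  {within I, continuous f} -> {within I, continuous (fun t => invmx (f t))}.
Proof.
move=> uf /subspace_continuousP cf.
by apply/subspace_continuousP => t It; apply: cvg_invmx; [exact: uf|exact: cf].
Qed.

Lemma within_ginv m n I (f : R -> 'M[R]_(m, n)) :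
  (forall t, I t -> row_full (f t)) ->
  {within I, continuous f} -> {within I, continuous (fun t => ginv (f t))}.
Proof.
move=> ff cf; under eq_fun do rewrite ginv.unlock.
apply: within_mulmx; last exact: within_trmx.
apply: within_invmx => [t It|]; first by rewrite gram_unit// ff.
by apply: within_mulmx => //; exact: within_trmx.
Qed.

Lemma deriv_on_mul m n p I (f : R -> 'M[R]_(m, n)) (g : R -> 'M[R]_(n, p)) t :
  no_isolated_point I -> C1_on I f -> C1_on I g -> I t ->
  deriv_on I (fun s => f s *m g s) t =
  deriv_on I f t *m g t + f t *m deriv_on I g t.
Proof.
by move=> aI cf cg It; apply: deriv_onE => //; apply: has_deriv_mul; exact: C1_has_deriv.
Qed.

Lemma C1_mul m n p I (f : R -> 'M[R]_(m, n)) (g : R -> 'M[R]_(n, p)) :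
  no_isolated_point I -> C1_on I f -> C1_on I g -> C1_on I (fun t => f t *m g t).
Proof.
move=> aI cf cg; apply: (has_deriv_C1 aI) => [t It|].
  by apply: has_deriv_mul; exact: C1_has_deriv.
have /C1_continuous ccf := cf; have /C1_continuous ccg := cg.
by apply: within_addmx; apply: within_mulmx => //; [case: cf|case: cg].
Qed.

Lemma C1_tr m n I (f : R -> 'M[R]_(m, n)) :
  no_isolated_point I -> C1_on I f -> C1_on I (fun t => (f t)^T).
Proof.
move=> aI cf; apply: (has_deriv_C1 aI) => [t It|].
  by apply: has_deriv_tr; exact: C1_has_deriv.
by apply: within_trmx; case: cf.
Qed.

Lemma C1_inv n I (f : R -> 'M[R]_n) : no_isolated_point I ->
  (forall t, I t -> f t \in unitmx) -> C1_on I f -> C1_on I (fun t => invmx (f t)).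
Proof.
move=> aI uf cf; apply: (has_deriv_C1 aI) => [t It|].
  by apply: has_deriv_inv => //; exact: C1_has_deriv.
have /C1_continuous/(within_invmx uf) ci := cf.
by apply/within_oppmx/within_mulmx => //; apply: within_mulmx => //; case: cf.
Qed.

Lemma C1_ginv m n I (f : R -> 'M[R]_(m, n)) : no_isolated_point I ->
  (forall t, I t -> row_full (f t)) -> C1_on I f -> C1_on I (fun t => ginv (f t)).
Proof.
move=> aI ff cf; under eq_fun do rewrite ginv.unlock.
apply: C1_mul => //; last exact: C1_tr.
apply: C1_inv => // [t It|]; first by rewrite gram_unit// ff.
by apply: C1_mul => //; exact: C1_tr.
Qed.

Lemma has_deriv_cst {V : normedModType R} I (a : V) t : has_deriv I (fun=> a) t 0.
Proof.
by rewrite /has_deriv /diff_quot subrr; under eq_fun do rewrite scaler0; exact: cvg_cst.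
Qed.

Lemma C1_cst {V : normedModType R} I (a : V) : no_isolated_point I -> C1_on I (fun=> a).
Proof.
move=> aI; apply: (@has_deriv_C1 _ _ _ (fun=> 0)) => // [t It|]; first exact: has_deriv_cst.
exact: cst_continuous.
Qed.

(** Derivatives are local: this is what compares those relative to [I] with those relative to the
    smaller domain of a local solution. *)
Lemma within_openI (O I : set R) (F : set_system R) {FF : Filter F} :
  F O -> within (O `&` I) F = within I F.
Proof.
move=> FO; apply/seteqP; split => A; rewrite /within/=.
  by apply: filterS2 FO => s Os + Is; apply.
by apply: filterS => s + [_ Is]; apply.
Qed.

Lemma dnbhs_open (O : set R) t : open O -> O t -> t^' O.
Proof. by move=> oO Ot; apply: nbhs_dnbhs; exact: open_nbhs_nbhs. Qed.

Lemma has_deriv_openI {V : normedModType R} (O I : set R) (f : R -> V) t l :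
  open O -> O t -> has_deriv (O `&` I) f t l = has_deriv I f t l.
Proof. by move=> oO Ot; rewrite /has_deriv within_openI//; exact: dnbhs_open. Qed.

Lemma deriv_on_openI {V : normedModType R} (O I : set R) (f : R -> V) t :
  open O -> O t -> deriv_on (O `&` I) f t = deriv_on I f t.
Proof. by move=> oO Ot; rewrite /deriv_on within_openI//; exact: dnbhs_open. Qed.

Lemma no_isolated_point_openI (O I : set R) :
  open O -> no_isolated_point I -> no_isolated_point (O `&` I).
Proof. by move=> oO aI t [Ot It]; rewrite within_openI; [exact: aI|exact: dnbhs_open]. Qed.

Lemma C1_on_openI {V : normedModType R} (O I : set R) (f : R -> V) :
  open O -> no_isolated_point I -> C1_on I f -> C1_on (O `&` I) f.
Proof.
move=> oO aI cf; apply: (@has_deriv_C1 _ _ _ (deriv_on I f)).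
- exact: no_isolated_point_openI.
- by move=> t [Ot It]; rewrite has_deriv_openI//; exact: C1_has_deriv.
- by apply: continuous_subspaceW cf.2; exact: subIsetr.
Qed.

Lemma interval_no_isolated_point I : is_interval I ->
  (exists a b, [/\ I a, I b & a < b]) -> no_isolated_point I.
Proof.
move=> iI [a [b [Ia Ib ab]]] t It; apply: Build_ProperFilter_ex => A.
rewrite /within/= => /nbhs_ballP[e /= e0 eA].
have [at_|ta] := ltP a t.
  (* The point [t - e / 2] lies in the ball but perhaps not in [I]; the maximum with [a] keeps it
     between [a] and [t]. *)
  exists (Num.max a (t - e / 2)).
  have mt : Num.max a (t - e / 2) < t.
    by rewrite gt_max at_/= ltrBlDr ltrDl divr_gt0.
  apply: eA; [|by rewrite lt_eqF|].
    rewrite /ball/= gtr0_norm ?subr_gt0// ltrBlDr -ltrBlDl lt_max; apply/orP; right.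
    by rewrite ltrD2l ltrN2 ltr_pdivrMr// ltr_pMr// ltr1n.
  by apply: (iI a t) => //; rewrite le_max lexx/= ltW.
have tb := le_lt_trans ta ab.
exists (Num.min b (t + e / 2)).
have mt : t < Num.min b (t + e / 2).
  by rewrite lt_min tb/= ltrDl divr_gt0.
apply: eA; [|by rewrite gt_eqF|].
  rewrite /ball/= ltr0_norm ?subr_lt0// opprB ltrBlDr gt_min; apply/orP; right.
  by rewrite addrC ltrD2r ltr_pdivrMr// ltr_pMr// ltr1n.
by apply: (iI t b) => //; rewrite ge_min lexx/= andbT ltW.
Qed.

End relative_derivative.

(** * Local existence for linear ODEs *)

Section uniform_contraction.
Context {R : realType} {T : topologicalType} {V : completeNormedModType R}.
Variable Phi : (T -> V) -> (T -> V).
Hypothesis Phi_cont : forall u, continuous u -> continuous (Phi u).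
Hypothesis Phi_contract : forall u v M, continuous u -> continuous v ->
  (forall s, `|u s - v s| <= M) -> forall s, `|Phi u s - Phi v s| <= M / 2.

(** Banach's fixed-point argument in the supremum norm with contraction factor 1/2, carried out on
    functions directly: the iterates converge uniformly, so their limit is continuous. *)
Lemma uniform_contraction_fixpoint (u0 : T -> V) (M : R) : continuous u0 ->
  (forall s, `|Phi u0 s - u0 s| <= M) ->
  exists2 u, continuous u & forall s, Phi u s = u s.
Proof.
move=> cu0 Mu0; pose u n := iter n Phi u0.
have cu n : continuous (u n) by elim: n => //= n; exact: Phi_cont.
have step n s : `|u n.+1 s - u n s| <= M / 2 ^+ n.
  elim: n s => [|n IHn] s; first by rewrite expr0 divr1 Mu0.
  by rewrite exprSr invfM mulrA; exact: (Phi_contract (cu n.+1) (cu n) IHn).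
(* This is the geometric tail: the sum of the step bounds [M / 2 ^+ k] over all [k >= n]. *)
pose e n := M * 2 / 2 ^+ n.
have eS n : e n.+1 = M / 2 ^+ n by rewrite /e exprS invfM mulrA mulfK.
have tail k n s : `|u (k + n)%N s - u n s| <= e n - e (k + n)%N.
  elim: k => [|k IHk]; first by rewrite !subrr normr0.
  rewrite addSn -(subrKA (u (k + n)%N s)) (le_trans (ler_normD _ _))//.
  have -> : e n - e (k + n).+1 = e (k + n).+1 + (e n - e (k + n)%N).
    have eD : e (k + n)%N = e (k + n).+1 + e (k + n).+1.
      by rewrite eS /e -mulrA (mulrC 2) mulrA mulr_natr mulr2n.
    by rewrite eD; ring.
  by rewrite lerD// eS step.
(* The sign of [M] is read off at a point of [T]; if [T] is empty, there is nothing to prove. *)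
have [[s0 _]|T0] := pselect (exists s : T, True); last first.
  by exists u0 => // s; case: T0; exists s.
have M0 : 0 <= M by exact: le_trans (Mu0 s0).
have e0 n : 0 <= e n by rewrite /e divr_ge0 ?mulr_ge0// exprn_ge0.
have elt x : 0 < x -> exists n, e n < x.
  move=> x0; have h1 : `|2^-1 : R| < 1 by rewrite gtr0_norm ?invf_lt1 ?ltr1n.
  have /cvgrPdist_lt/(_ _ x0)[n _ /(_ n (leqnn n))] : e @ \oo --> (0 : R).
    rewrite -(mulr0 (M * 2)) /e; under eq_fun do rewrite -exprVn.
    by apply: cvgM; [exact: cvg_cst|exact: cvg_expr].
  by rewrite sub0r normrN ger0_norm// => ex; exists n.
have tail' n m s : (n <= m)%N -> `|u m s - u n s| <= e n.
  by move=> nm; rewrite -(subnK nm) (le_trans (tail _ _ _))// lerBlDr lerDl.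
have cvgu s : cvg ((fun n => u n s) @ \oo).
  apply: cauchy_cvg; apply: cauchy_exP => x x0.
  have [n enx] := elt _ x0; exists (u n s); exists n => // m /= nm.
  by rewrite -ball_normE/= distrC (le_lt_trans (tail' _ _ _ nm)).
pose l s := lim ((fun n => u n s) @ \oo).
have lu n s : `|l s - u n s| <= e n.
  apply/ler_addgt0Pr => x x0.
  have /cvgrPdist_le/(_ _ x0)[k _ kx] := cvgu s.
  rewrite -(subrKA (u (maxn n k) s)) (le_trans (ler_normD _ _))// addrC.
  by rewrite lerD ?tail' ?leq_maxl//; apply: kx; rewrite /= leq_maxr.
have cl : continuous l.
  move=> s; apply/cvgrPdist_lt => x x0.
  have x30 : 0 < x / 3 by rewrite divr_gt0.
  have [n enx] := elt _ x30.
  have /cvgrPdist_lt/(_ _ x30) := cu n s; apply: filterS => s' ss'.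
  have -> : l s - l s' = (l s - u n s) + (u n s - u n s') - (l s' - u n s').
    by rewrite addrA subrK opprB addrA subrK.
  have -> : x = x / 3 + x / 3 + x / 3 by field.
  rewrite (le_lt_trans (ler_normB _ _))// ltrD//; last exact: le_lt_trans enx.
  rewrite (le_lt_trans (ler_normD _ _))// ltrD//; exact: le_lt_trans enx.
exists l => // s; apply/eqP; rewrite -subr_eq0 -normr_le0.
apply/ler_addgt0Pr => x x0; rewrite add0r.
have [n enx] := elt _ x0.
rewrite -(subrKA (u n.+1 s)) (le_trans (ler_normD _ _))//.
have := Phi_contract cl (cu n) (lu n) s => /= h.
have h2 : `|u n.+1 s - l s| <= e n.+1 by rewrite distrC.
(* Both bounds equal half of [e n], so their sum is [e n]. *)
rewrite (le_trans (lerD h h2))//.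
by rewrite (le_trans _ (ltW enx))// eS /e; lra.
Qed.

End uniform_contraction.

(** * Primitives of continuous functions and their estimates *)

Section primitive.
Context {R : realType}.
Notation mu := (@lebesgue_measure R).

(* Integrating from [t - 1] makes the FTC applicable on both sides of [t]. *)
Definition prim (t : R) (f : R -> R) (s : R) : R :=
  \int[mu]_(x in `[t - 1, s]) f x - \int[mu]_(x in `[t - 1, t]) f x.

Lemma prim0 (t : R) (f : R -> R) : prim t f t = 0.
Proof. by rewrite /prim subrr. Qed.

Lemma is_derive_prim (t : R) (f : R -> R) (s : R) : continuous f -> `|s - t| < 1 ->
  is_derive s 1 (prim t f) (f s).
Proof.
move=> cf; rewrite ltr_norml => /andP[ts st].
have st1 : s < t + 1 by lra.
have ts1 : t - 1 < s by lra.
have intf : mu.-integrable `[t - 1, t + 1] (EFin \o f).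
  apply: continuous_compact_integrable; first exact: segment_compact.
  exact: continuous_subspaceT.
have [df f's] := continuous_FTC1_closed st1 intf ts1 (cf s).
rewrite /prim -[f s]subr0; apply: is_deriveB.
by rewrite -f's derive1E; exact/derivableP.
Qed.

Lemma has_deriv_is_derive (f : R -> R) (I : set R) (s l : R) :
  is_derive s 1 f l -> has_deriv I f s l.
Proof.
move=> [df <-]; rewrite /has_deriv; apply: cvg_within_filter.
apply/cvgrPdist_le => e e0.
have /cvgrPdist_le/(_ _ e0)/nbhs_ballP[r /= r0 rP] := df.
apply/nbhs_ballP; exists r => // x sx xs.
have := rP (x - s); rewrite /ball/= sub0r normrN distrC => /(_ sx).
rewrite subr_eq0 => /(_ xs); rewrite /diff_quot/=.
by rewrite /GRing.scale/= mulr1 subrK.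
Qed.

Lemma lipschitz_ball (D D' : R -> R) (t M : R) : 
  (forall s, `|s - t| < 1 -> is_derive s 1 D (D' s)) ->
  (forall s, `|s - t| < 1 -> `|D' s| <= M) ->
  forall s, `|s - t| < 1 -> `|D s - D t| <= M * `|s - t|.
Proof.
move=> DD' D'M s st.
have main a b : `|a - t| < 1 -> `|b - t| < 1 -> a <= b -> `|D b - D a| <= M * (b - a).
  rewrite !ltr_norml => /andP[a1 a2] /andP[b1 b2] ab.
  have inb x : a <= x -> x <= b -> `|x - t| < 1.
    by move=> ax xb; rewrite ltr_norml; apply/andP; split; lra.
  have [||c cab ->] := @MVT_segment R D D' a b ab.
  - by move=> x; rewrite in_itv/= => /andP[/ltW ax /ltW xb]; apply: DD'; exact: inb.
  - apply: continuous_in_subspaceT => x; rewrite inE/= in_itv/= => /andP[ax xb].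
    apply: differentiable_continuous; apply/derivable1_diffP.
    by have [] := DD' x (inb _ ax xb).
  rewrite normrM [X in _ * X]ger0_norm ?subr_ge0// ler_wpM2r ?subr_ge0//.
  by move: cab; rewrite in_itv/= => /andP[ac cb]; apply: D'M; exact: inb.
have tt : `|t - t| < 1 by rewrite subrr normr0.
have [ts|/ltW st'] := leP t s.
  by rewrite [X in M * X]ger0_norm ?subr_ge0//; exact: main.
by rewrite distrC [X in M * X]ler0_norm ?subr_le0// opprB; exact: main.
Qed.

(** Mean value inequality for the difference of the two primitives, which vanishes at [t] and has
    derivative [f - g]. *)
Lemma primB_le (t : R) (f g : R -> R) (M s : R) : continuous f -> continuous g ->
  (forall x, `|f x - g x| <= M) -> `|s - t| < 1 ->
  `|prim t f s - prim t g s| <= M * `|s - t|.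
Proof.
move=> cf cg fgM st.
have := @lipschitz_ball (fun x => prim t f x - prim t g x) (fun x => f x - g x) t M.
rewrite /= !prim0 subrr => /(_ _ _ s st); rewrite subr0; apply => // x xt.
by apply: is_deriveB; exact: is_derive_prim.
Qed.

Lemma mx_entry_le m n (A : 'M[R]_(m, n)) i j : `|A i j| <= `|A|.
Proof.
rewrite [leRHS]/Num.Def.normr/= mx_normrE.
exact: (le_bigmax _ (fun ij : 'I_m * 'I_n => `|A ij.1 ij.2|) (i, j)).
Qed.

Lemma mx_norm_le m n (A : 'M[R]_(m, n)) M : 0 <= M ->
  (forall i j, `|A i j| <= M) -> `|A| <= M.
Proof.
move=> M0 AM; rewrite [leLHS]/Num.Def.normr/= mx_normrE.
by apply: bigmax_le => //= -[i j] _; exact: AM.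
Qed.

(** The norm is the largest absolute value of an entry, and each entry of the product is a sum of
    [n] terms; hence the factor [n]. *)
Lemma mulmx_norm_le m n p (A : 'M[R]_(m, n)) (B : 'M[R]_(n, p)) :
  `|A *m B| <= n%:R * `|A| * `|B|.
Proof.
apply: mx_norm_le => [|i j]; first by rewrite !mulr_ge0.
rewrite mxE (le_trans (ler_norm_sum _ _ _))//.
suff : \sum_k `|A i k * B k j| <= \sum_(k < n) `|A| * `|B|.
  by rewrite sumr_const card_ord -mulrA mulr_natl.
by apply: ler_sum => k _; rewrite normrM ler_pM// mx_entry_le.
Qed.

Definition cprim d (t : R) (f : R -> 'cV[R]_d) (s : R) : 'cV[R]_d :=
  \col_i prim t (fun x => f x i 0) s.

Lemma continuous_entry d (f : R -> 'cV[R]_d) i : continuous f ->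
  continuous (fun x => f x i 0).
Proof. by move=> cf x; exact: (cvg_mxP _ _).1 (cf x) i 0. Qed.

Lemma cprim0 d t (f : R -> 'cV[R]_d) : cprim t f t = 0.
Proof. by apply/colP => i; rewrite !mxE prim0. Qed.

Lemma has_deriv_cprim d t (f : R -> 'cV[R]_d) I s : continuous f ->
  `|s - t| < 1 -> has_deriv I (cprim t f) s (f s).
Proof.
move=> cf st; apply/cvg_mxP => i j; rewrite (ord1 j).
have := has_deriv_is_derive I (is_derive_prim (continuous_entry (i := i) cf) st).
by apply: cvg_trans; apply: near_eq_cvg; apply: nearW => x; rewrite /diff_quot !mxE.
Qed.

Lemma cprimB_le d t (f g : R -> 'cV[R]_d) M s : continuous f -> continuous g ->
  (forall x, `|f x - g x| <= M) -> `|s - t| < 1 ->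
  `|cprim t f s - cprim t g s| <= M * `|s - t|.
Proof.
move=> cf cg fgM st; have M0 : 0 <= M by exact: le_trans (fgM s).
apply: mx_norm_le => [|i j]; first by rewrite mulr_ge0.
rewrite !mxE; apply: primB_le => // [||x]; [exact: continuous_entry..|].
by rewrite (le_trans _ (fgM x))// (le_trans _ (mx_entry_le _ i 0))// !mxE.
Qed.

End primitive.

(** Makes matrices available as a [completeNormedModType], the value type of the fixed-point
    lemma. *)
HB.instance Definition _ (R : realType) (m n : nat) :=
  Uniform_isComplete.Build 'M[R]_(m, n) cauchy_cvg.

(** * Picard iteration on a segment of the interval *)

Section linear_ode.
Context {R : realType}.

Lemma cprim_cst0 d (t s : R) : cprim t (fun=> 0 : 'cV[R]_d) s = 0.
Proof.
suff prim_cst0 f : (forall x, f x = 0) -> prim t f s = 0.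
  by apply/colP => i; rewrite !mxE; exact: prim_cst0.
by move=> f0; rewrite /prim /Rintegral !integral0_eq ?subrr// => x _; rewrite f0.
Qed.

Definition clamp (a b s : R) : R := Num.max a (Num.min b s).

Lemma clamp_itv a b s : a <= b -> a <= clamp a b s <= b.
Proof. by move=> ab; rewrite /clamp le_max lexx/= ge_max ab/= ge_min lexx. Qed.

Lemma clamp_id a b s : a <= s <= b -> clamp a b s = s.
Proof. by move=> /andP[as_ sb]; rewrite /clamp min_r// max_r. Qed.

Lemma clamp_continuous a b : continuous (clamp a b).
Proof.
move=> s; apply: continuous_max; first exact: cst_continuous.
by apply: continuous_min; [exact: cst_continuous|exact: cvg_id].
Qed.

(** Treats interior points and endpoints of [I] alike: on a side of [t] where [I] has no points, the
    segment ends at [t] itself. *)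
Lemma interval_local_segment (I : set R) t e : is_interval I -> I t -> 0 < e ->
  exists a b d, [/\ t - e <= a <= t, t <= b <= t + e,
    forall s, a <= s <= b -> I s, 0 < d &
    forall s, I s -> t - d < s < t + d -> a <= s <= b].
Proof.
move=> iI It e0.
have [a [da [aI da0 aP]]] : exists a da, [/\ t - e <= a <= t /\ I a, 0 < da &
    forall s, I s -> t - da < s -> a <= s].
  have [[s [Is st]]|nI] := pselect (exists s, I s /\ s < t).
    exists (Num.max s (t - e)), (Num.min (t - s) e); split.
    - rewrite le_max lexx orbT/= ge_max (ltW st)/= gerBl (ltW e0); split => //.
      by apply: (iI s t) => //; rewrite le_max lexx/= ge_max (ltW st)/= gerBl ltW.
    - by rewrite lt_min subr_gt0 st.
    - move=> x _ tx; rewrite ge_max; move: tx; rewrite ltrBlDl -ltrBlDr lt_min.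
      by move=> /andP[]; lra.
  exists t, 1; split; rewrite ?lexx ?gerBl ?(ltW e0)// => s Is _.
  by rewrite leNgt; apply/negP => st; apply: nI; exists s.
have [b [db [bI db0 bP]]] : exists b db, [/\ t <= b <= t + e /\ I b, 0 < db &
    forall s, I s -> s < t + db -> s <= b].
  have [[s [Is ts]]|nI] := pselect (exists s, I s /\ t < s).
    exists (Num.min s (t + e)), (Num.min (s - t) e); split.
    - rewrite ge_min lexx orbT/= andbT le_min (ltW ts)/= lerDl (ltW e0); split => //.
      by apply: (iI t s) => //; rewrite ge_min lexx/= andbT le_min (ltW ts)/= lerDl ltW.
    - by rewrite lt_min subr_gt0 ts.
    - move=> x _; rewrite -ltrBlDl lt_min le_min.
      by move=> /andP[]; lra.
  exists t, 1; split; rewrite ?lexx ?lerDl ?(ltW e0)// => s Is _.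
  by rewrite leNgt; apply/negP => st; apply: nI; exists s.
exists a, b, (Num.min da db); split; [by case: aI|by case: bI| | |].
- by move=> s asb; apply: (iI a b) => //; [case: aI|case: bI].
- by rewrite lt_min da0.
- move=> s Is /andP[sa sb]; apply/andP; split.
    by apply: aP => //; rewrite (le_lt_trans _ sa)// lerD2l lerN2 ge_min lexx.
  by apply: bP => //; rewrite (lt_le_trans sb)// lerD2l ge_min lexx orbT.
Qed.

(** The solution is a fixed point of [u0] plus the primitive of [A u], which is a contraction on a
    short enough segment around [t]. *)
Lemma linear_ode_local d (I : set R) (A : R -> 'M[R]_d) t (u0 : 'cV[R]_d) :
  is_interval I -> {within I, continuous A} -> I t ->
  exists2 e, 0 < e & exists2 u : R -> 'cV[R]_d, u t = u0 &
    forall s, (`]t - e, t + e[ `&` I) s ->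
      has_deriv (`]t - e, t + e[ `&` I) u s (A s *m u s).
Proof.
move=> iI /subspace_continuousP cA It.
(* A Lipschitz constant of [u |-> A s *m u] for [s] near [t]: the factor [d] comes from
   [mulmx_norm_le], and [|A t| + 1] bounds [|A s|]. *)
pose K := d%:R * (`|A t| + 1).
have K0 : 0 <= K by rewrite mulr_ge0// addr_ge0.
have [e0 e00 Ae0] : exists2 e0, 0 < e0 &
    forall s, I s -> `|s - t| < e0 -> `|A s| <= `|A t| + 1.
  have /cvgrPdist_lt/(_ _ ltr01) := cA t It.
  rewrite near_withinE => /nbhs_ballP[e0 /= e00 e0P]; exists e0 => // s Is st.
  have := e0P s; rewrite /ball/= distrC => /(_ st Is)/ltW.
  move=> h; rewrite -[A s](subrK (A t)) addrC (le_trans (ler_normD _ _))//.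
  by rewrite lerD2l distrC.
(* The three terms ensure the bound on [A], the inequality [e < 1] required by [cprim], and the
   contraction factor [K * e <= 1 / 2]; [K + 1] is used because [K] may vanish. *)
pose e := Num.min (e0 / 2) (Num.min 2^-1 (2 * (K + 1))^-1).
have e_gt0 : 0 < e.
  by rewrite !lt_min divr_gt0// invr_gt0 ltr0n invr_gt0 mulr_gt0//= ltr_wpDl.
have ee0 : e < e0.
  by rewrite gt_min ltr_pdivrMr// ltr_pMr// ltr1n.
have e1 : e < 1.
  rewrite gt_min; apply/orP; right; rewrite gt_min; apply/orP; left.
  by rewrite invf_lt1 ?ltr1n.
have eK : K * e <= 2^-1.
  have : e <= (2 * (K + 1))^-1 by rewrite !ge_min lexx !orbT.
  move=> /(ler_wpM2l K0)/le_trans; apply.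
  by rewrite invfM mulrCA ler_piMr// ler_pdivrMr ?ltr_wpDl// mul1r lerDl.
have [a [b [f [/andP[ea at_] /andP[tb be] abI f0 fab]]]] :=
  interval_local_segment iI It e_gt0.
have ab : a <= b := le_trans at_ tb.
(* Precomposing with the projection onto [a, b] makes the estimates of the
   Picard iteration uniform on the whole line. *)
pose cl := clamp a b.
have clI s : I (cl s) by apply: abI; exact: clamp_itv.
have clt s : `|cl s - t| <= e.
  have /andP[] := clamp_itv s ab; rewrite -/cl => acl clb.
  by rewrite ler_norml; apply/andP; split; lra.
have clt1 s : `|cl s - t| < 1 := le_lt_trans (clt s) e1.
have AclM s : `|A (cl s)| <= `|A t| + 1 by apply: Ae0 => //; exact: le_lt_trans ee0.
have cAcl : continuous (fun s => A (cl s)).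
  move=> s; apply: (@cvg_comp _ _ _ cl A (nbhs s) _ _ _ (cA (cl s) (clI s))) => B.
  rewrite /within/= => nB.
  have nB' : nbhs s (cl @^-1` [set x | I x -> B x]) by exact: (@clamp_continuous a b s).
  by apply: filterS nB' => x /(_ (clI x)).
have cmul (u : R -> 'cV[R]_d) : continuous u -> continuous (fun s => A (cl s) *m u s).
  by move=> cu s; apply: cvg_mulmx; [exact: cAcl|exact: cu].
pose Phi (u : R -> 'cV[R]_d) s := u0 + cprim t (fun z => A (cl z) *m u z) (cl s).
have Phi_cont u : continuous u -> continuous (Phi u).
  move=> cu s; apply: cvgD; first exact: cvg_cst.
  have := has_deriv_cvg (has_deriv_cprim setT (cmul u cu) (clt1 s)).
  rewrite withinET; apply: (@cvg_comp _ _ _ cl _ (nbhs s)).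
  exact: (@clamp_continuous a b s).
have AM (u : R -> 'cV[R]_d) (M s : R) : `|u s| <= M -> `|A (cl s) *m u s| <= K * M :> R.
  move=> uM; rewrite (le_trans (mulmx_norm_le _ _))//.
  by rewrite ler_pM ?mulr_ge0// ler_wpM2l.
have Phi_contract (u v : R -> 'cV[R]_d) (M : R) : continuous u -> continuous v ->
    (forall s, `|u s - v s| <= M) -> forall s, `|Phi u s - Phi v s| <= M / 2.
  move=> cu cv uvM s; have M0 : 0 <= M by exact: le_trans (uvM s).
  rewrite /Phi opprD addrACA subrr add0r.
  have AuvM x : `|A (cl x) *m u x - A (cl x) *m v x| <= K * M.
    by rewrite -mulmxBr; exact: (AM (fun s => u s - v s)).
  rewrite (le_trans (cprimB_le (cmul u cu) (cmul v cv) AuvM (clt1 s)))//.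
  rewrite mulrAC mulrC ler_wpM2l// (le_trans _ eK)// ler_wpM2l//.
have u0c : continuous (fun _ : R => u0) by move=> s; exact: cvg_cst.
have Phi_u0 s : `|Phi (fun=> u0) s - u0| <= K * `|u0| * e.
  rewrite /Phi addrAC subrr add0r.
  have cst0c : continuous (fun _ : R => 0 : 'cV[R]_d) by move=> x; exact: cvg_cst.
  have Au0M x : `|A (cl x) *m u0 - 0| <= K * `|u0|.
    by rewrite subr0; exact: (AM (fun=> u0)).
  have := cprimB_le (cmul _ u0c) cst0c Au0M (clt1 s).
  rewrite cprim_cst0 subr0 => /le_trans; apply.
  by rewrite ler_wpM2l// mulr_ge0.
have [u cu Phiu] :=
  @uniform_contraction_fixpoint R R 'cV[R]_d Phi Phi_cont Phi_contract _ _ u0c Phi_u0.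
exists f => //; exists u.
  by rewrite -Phiu /Phi /cl clamp_id ?at_// cprim0 addr0.
move=> s [/=]; rewrite in_itv/= => sf Is.
(* On the part of [I] within [f] of [t] the projection [cl] is the identity, so there the
   fixed-point equation can be differentiated. *)
have clf x : (`]t - f, t + f[ `&` I) x -> cl x = x.
  by move=> [/=]; rewrite in_itv/= => xf Ix; apply: clamp_id; exact: fab.
have cls : cl s = s by apply: clf; split; rewrite //= in_itv.
have st : `|s - t| < 1 by rewrite -cls.
have := has_deriv_cprim (`]t - f, t + f[ `&` I) (cmul u cu) st; rewrite cls.
apply: cvg_trans; apply: near_eq_cvg; rewrite near_withinE; apply: nearW => x xJ.
by rewrite /diff_quot -(Phiu x) -(Phiu s) /Phi cls (clf x xJ) opprD addrACA subrr add0r.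
Qed.

End linear_ode.

(** * The reduction procedure *)

Section reduction.
Context {R : realType} (I : set R) (m : nat) (E F : R -> 'M[R]_m).
Variables (r : nat -> nat) (mu : nat).
Hypothesis aI : no_isolated_point I.

Lemma redE_S (B : red_data m r) i t :
  redE I E F B i.+1 t = (redY B i t)^T *m redE I E F B i t *m redC B i t.
Proof. by rewrite /redE /=; case: red_pair. Qed.

Lemma redF_S (B : red_data m r) i t :
  redF I E F B i.+1 t = (redY B i t)^T *m
    (redF I E F B i t *m redC B i t + redE I E F B i t *m deriv_on I (redC B i) t).
Proof. by rewrite /redF /redE /=; case: red_pair. Qed.

(** Replaces the kernel formed with [redZ] by [S_i], which depends on [E_i] and [F_i] alone. *)
Lemma redC_basis (B : red_data m r) i t :
  red_admissible I E F B mu -> (i < mu)%N -> I t ->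
  is_basis (Ssub (redE I E F B i t) (redF I E F B i t)) (redC B i t).
Proof.
move=> adm imu It; have [_ Zb Cb _] := adm i imu.
by rewrite -(mxker_orthcompl (redF I E F B i t) (Zb t It)); exact: Cb.
Qed.

(** The matrix [G] undoes all factors [Y_j^*] and recovers the coefficients obtained by inserting
    [x = P u] into the original DAE. It is chosen separately at each [t]. *)
Lemma redCprod_invariant (B : red_data m r) i :
  red_admissible I E F B mu -> (i <= mu)%N ->
  C1_on I (redCprod B i) /\ forall t, I t -> row_full (redCprod B i t) /\
  exists G : 'M[R]_(m, rsize m r i), [/\ row_full G,
    G *m redE I E F B i t = E t *m redCprod B i t &
    G *m redF I E F B i t =
      F t *m redCprod B i t + E t *m deriv_on I (redCprod B i) t].
Proof.
move=> adm; elim: i => [_|i IHi imu].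
  split=> [|t It]; first exact: C1_cst.
  split; first by rewrite /row_full mxrank1.
  exists 1%:M; rewrite (deriv_onE aI It (has_deriv_cst I _ t)).
  by rewrite mulmx0 addr0 !mul1mx !mulmx1; split=> //; rewrite /row_full mxrank1.
have [C1P PG] := IHi (ltnW imu); have [Yb Zb Cb C1C] := adm i imu.
split=> [|t It]; first exact: C1_mul.
have [fP [G [fG GE GF]]] := PG t It.
have /is_basisP[SC fC] := redC_basis adm imu It.
have /is_basisP[EY fY] := Yb t It.
split; first exact: row_full_mul.
exists (G *m (ginv (redY B i t))^T); split.
- by apply: row_full_mul => //; exact: row_full_tr_ginv.
- rewrite redE_S -!mulmxA tr_ginvK//; last by rewrite -EY; exact: mxim_mull.
  by rewrite mulmxA GE mulmxA.
- rewrite redF_S -!mulmxA tr_ginvK//.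
    rewrite mulmxDr !mulmxA GF GE deriv_on_mul// mulmxDl mulmxDr -!mulmxA.
    by rewrite -addrA.
  (* The columns of [F_i C_i] lie in the image of [E_i] because those of [C_i] lie in [S_i]; for
     [E_i C_i'] this is immediate. *)
  rewrite -EY => _ [z _ <-].
  have [w _ Ew] : Ssub (redE I E F B i t) (redF I E F B i t) (redC B i t *m z).
    by rewrite SC; exists z.
  exists (w + deriv_on I (redC B i) t *m z) => //.
  by rewrite mulmxDr mulmxDl -!mulmxA Ew.
Qed.

Lemma C1_redCprod (B : red_data m r) i :
  red_admissible I E F B mu -> (i <= mu)%N -> C1_on I (redCprod B i).
Proof. by move=> adm imu; have [] := redCprod_invariant adm imu. Qed.

Lemma row_full_redCprod (B : red_data m r) i t :
  red_admissible I E F B mu -> (i <= mu)%N -> I t -> row_full (redCprod B i t).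
Proof. by move=> adm imu It; have [_ /(_ t It)[]] := redCprod_invariant adm imu. Qed.

(** The left side says that [u] lies in [S_i]; applying the injective [G] to this condition
    expresses it by [E], [F], [P] and [P'] only. *)
Lemma mxim_redCprodS (B : red_data m r) i t (u : 'cV[R]_(rsize m r i)) :
  red_admissible I E F B mu -> (i < mu)%N -> I t ->
  mxim (redCprod B i.+1 t) (redCprod B i t *m u) <->
  mxim (E t *m redCprod B i t)
    ((F t *m redCprod B i t + E t *m deriv_on I (redCprod B i) t) *m u).
Proof.
move=> adm imu It.
have [_ /(_ t It)[fP [G [fG GE GF]]]] := redCprod_invariant adm (ltnW imu).
have /is_basisP[SC fC] := redC_basis adm imu It.
rewrite -GE -GF; split=> [[v _ /=]|[w _ Gw]].
  rewrite -mulmxA => /(row_full_inj fP) <-.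
  have [w _ Ew] : Ssub (redE I E F B i t) (redF I E F B i t) (redC B i t *m v).
    by rewrite SC; exists v.
  by exists w => //; rewrite -!mulmxA Ew.
have : Ssub (redE I E F B i t) (redF I E F B i t) u.
  by exists w => //; apply: (row_full_inj fG); rewrite !mulmxA.
by rewrite SC => -[v _ <-]; exists v => //=; rewrite mulmxA.
Qed.

Lemma mxim_redCprod_subset (B B' : red_data m r) i :
  red_admissible I E F B mu -> red_admissible I E F B' mu -> (i <= mu)%N ->
  forall t, I t -> mxim (redCprod B' i t) `<=` mxim (redCprod B i t).
Proof.
move=> adm adm'; elim: i => [_ t It //|i IHi imu t It].
have {}IHi := IHi (ltnW imu).
(* By the induction hypothesis [H] expresses the product for [B'] in terms of that for [B], and it
   is continuously differentiable. *)
pose H t := ginv (redCprod B i t) *m redCprod B' i t.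
have C1P := C1_redCprod adm (ltnW imu).
have fP s : I s -> row_full (redCprod B i s) := row_full_redCprod adm (ltnW imu).
have C1H : C1_on I H.
  exact: C1_mul aI (C1_ginv aI fP C1P) (C1_redCprod adm' (ltnW imu)).
have PH s : I s -> redCprod B' i s = redCprod B i s *m H s.
  by move=> Is; rewrite mxim_ginvK//; [exact: fP|exact: IHi].
move=> _ [v _ <-] /=; set z := redC B' i t *m v.
have : mxim (redCprod B' i.+1 t) (redCprod B' i t *m z).
  by exists v => //=; rewrite mulmxA.
rewrite -mulmxA -/z => /(mxim_redCprodS z adm' imu It)[w _].
have -> : deriv_on I (redCprod B' i) t =
    deriv_on I (redCprod B i) t *m H t + redCprod B i t *m deriv_on I H t.
  rewrite -(deriv_on_mul aI C1P C1H It).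
  by apply: deriv_on_eq => // s /set_mem/PH.
rewrite (PH t It) => /substitute_factor EP; rewrite -mulmxA.
by apply/(mxim_redCprodS _ adm imu It); exists (H t *m w - deriv_on I H t *m z).
Qed.

Lemma mxim_redCprod_eq (B B' : red_data m r) t :
  red_admissible I E F B mu -> red_admissible I E F B' mu -> I t ->
  mxim (redCprod B' mu t) = mxim (redCprod B mu t).
Proof.
by move=> adm adm' It; apply/seteqP; split; exact: mxim_redCprod_subset.
Qed.

Lemma solution_mxim_redCprod (B : red_data m r) (O : set R) (x : R -> 'cV[R]_m) i :
  red_admissible I E F B mu -> open O -> dae_solution (O `&` I) E F x ->
  (i <= mu)%N -> forall s, (O `&` I) s -> mxim (redCprod B i s) (x s).
Proof.
move=> adm oO [C1x xP]; elim: i => [_ s _|i IHi imu s Js].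
  by exists (x s); rewrite ?mul1mx.
have {}IHi := IHi (ltnW imu); have [Os Is] := Js.
have aJ := no_isolated_point_openI oO aI.
pose u s := ginv (redCprod B i s) *m x s.
have fP s' : I s' -> row_full (redCprod B i s') := row_full_redCprod adm (ltnW imu).
have C1P := C1_on_openI oO aI (C1_redCprod adm (ltnW imu)).
have C1u : C1_on (O `&` I) u.
  by apply: C1_mul aJ (C1_ginv aJ _ C1P) C1x => s' [_]; exact: fP.
have xE s' : (O `&` I) s' -> x s' = redCprod B i s' *m u s'.
  move=> Js'; rewrite mxim_ginvK//; first by case: Js' => _; exact: fP.
  move=> _ [z _ <-]; have [v _ <-] := IHi s' Js'.
  by exists (v *m z) => //; rewrite mulmxA.
have x'E : deriv_on (O `&` I) x s = deriv_on I (redCprod B i) s *m u s +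
    redCprod B i s *m deriv_on (O `&` I) u s.
  rewrite -(deriv_on_openI I (redCprod B i) oO Os) -(deriv_on_mul aJ C1P C1u Js).
  by apply: deriv_on_eq => // s' /set_mem/xE.
have := xP s Js; rewrite x'E (xE s Js) => ode.
(* The inserted equation reads [E P u' + (F P + E P') u = 0], so [- u'] is the required preimage. *)
apply/(mxim_redCprodS _ adm imu Is); exists (- deriv_on (O `&` I) u s) => //.
apply/eqP; rewrite mulmxN eq_sym -subr_eq0 opprK -[X in _ == X]ode.
by rewrite mulmxDl mulmxDr !mulmxA -addrA addrC.
Qed.

Lemma solution_through (B : red_data m r) t (v : 'cV[R]_(rsize m r mu)) :
  is_interval I -> {within I, continuous E} -> {within I, continuous F} ->
  red_admissible I E F B mu -> (forall t, I t -> redE I E F B mu t \in unitmx) ->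
  I t -> Scan I E F t (redCprod B mu t *m v).
Proof.
move=> iI cE cF adm uE It; have [C1P PG] := redCprod_invariant adm (leqnn mu).
pose P := redCprod B mu; pose D t := F t *m P t + E t *m deriv_on I P t.
pose A t := - (ginv (E t *m P t) *m D t).
have fEP s : I s -> row_full (E s *m P s).
  move=> Is; have [_ [G [fG <- _]]] := PG s Is.
  by apply: row_full_mul => //; rewrite row_full_unit uE.
(* From [F P + E P' = G F_mu = (G E_mu) E_mu^-1 F_mu] and [G E_mu = E P], the columns of [D] lie in
   the image of [E P], where the projector [E P (E P)^+] acts as the identity. *)
have EPA s : I s -> E s *m P s *m A s = - D s.
  move=> Is; rewrite mulmxN mxim_ginvK//; first exact: fEP.
  have [_ [G [_ GE GF]]] := PG s Is; rewrite /D /P -GE -GF => _ [z _ <-].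
  exists (invmx (redE I E F B mu s) *m (redF I E F B mu s *m z)) => //.
  by rewrite -!mulmxA mulKVmx ?uE.
have cP := C1_continuous C1P.
have cA : {within I, continuous A}.
  apply: within_oppmx; apply: within_mulmx.
    by apply: within_ginv => //; exact: within_mulmx.
  by apply: within_addmx; apply: within_mulmx => //; case: C1P.
have [e e0 [u ut ode]] := linear_ode_local v iI cA It.
exists e; split=> //; set O := `]t - e, t + e[%classic in ode *.
have oO : open O by exact: interval_open.
have aJ := no_isolated_point_openI oO aI.
have C1u : C1_on (O `&` I) u.
  apply: (has_deriv_C1 aJ ode); apply: within_mulmx.
    by apply: continuous_subspaceW cA; exact: subIsetr.
  by apply/subspace_continuousP => s Js; exact: has_deriv_cvg (ode s Js).
have C1PJ := C1_on_openI oO aI C1P.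
exists (fun s => P s *m u s); split; last by rewrite ut.
split=> [|s Js]; first exact: C1_mul.
have [Os Is] := Js.
rewrite (deriv_on_mul aJ C1PJ C1u Js) (deriv_on_openI I P oO Os).
rewrite (deriv_onE aJ Js (ode s Js)) mulmxDr !mulmxA EPA// /D.
by rewrite mulNmx mulmxDl addrAC [X in X - _]addrC subrr.
Qed.

End reduction.

(** * Dimension and basis of the canonical subspace *)

Theorem theorem3p5 (R : realType) (I : set R) (m : nat)
    (E F : R -> 'M[R]_m) (mu : nat) (r theta : nat -> nat)
    (I_itv : is_interval I)
    (I_nondeg : exists a b, [/\ I a, I b & a < b])
    (E_cont : {within I, continuous E}) (F_cont : {within I, continuous F})
    (EF_reg : regular I E F mu r theta) :
  exists d : nat,
    [/\ d%:Z = (r 0%N)%:Z - \sum_(j < mu.-1) (theta j)%:Z,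
        d = r mu.-1,
        forall t, I t -> has_dim (Scan I E F t) d
      & forall B : red_data m r, red_admissible I E F B mu ->
          forall t, I t -> is_basis (Scan I E F t) (redCprod B mu t)].
Proof.
case: EF_reg => mu0 _ _ [B [adm pre Emu]].
have aI := interval_no_isolated_point I_itv I_nondeg.
have rmu : rsize m r mu = r mu.-1 by case: mu mu0 {adm pre Emu}.
(* If [r_{mu-1} = 0], then [E_mu] has size zero and is trivially invertible, so both cases of
   regularity are treated as one. *)
have uE t : I t -> redE I E F B mu t \in unitmx.
  case: Emu => [[_ uE]|r0] It; first exact: uE.
  by apply: unitmx_size0; rewrite rmu.
have ScanE t : I t -> Scan I E F t = mxim (redCprod B mu t).
  move=> It; apply/seteqP; split=> [z [e [e0 [x [solx <-]]]]|_ [v _ <-]].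
    apply: (solution_mxim_redCprod aI adm _ solx) => //.
    by split=> //=; rewrite in_itv/= ltrBlDr !ltrDl e0.
  exact: solution_through.
(* The data [B] supplied by regularity determine the subspace; any other admissible choice has a
   product with the same image. *)
have basisS (B' : red_data m r) : red_admissible I E F B' mu ->
    forall t, I t -> is_basis (Scan I E F t) (redCprod B' mu t).
  move=> adm' t It; apply/is_basisP; split.
    by rewrite ScanE//; exact: (mxim_redCprod_eq aI adm' adm).
  exact: (row_full_redCprod aI adm').
exists (r mu.-1); split => //; last first.
  by move=> t It; rewrite -rmu; exact: is_basis_has_dim (basisS B adm t It).
have [t [_ [It _ _]]] := I_nondeg.
(* Pre-regularity provides [\rank E_{i+1} = r_{i+1}] for [i + 1 < mu], so the last index that
   contributes is [mu - 2]. *)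
have rS i : (i.+1 < mu)%N -> (r i.+1 + theta i = r i)%N.
  move=> imu; have [_ <- _] := pre i.+1 imu t It.
  have [_ _ dimN] := pre i (ltnW imu) t It.
  have [Yb _ _ _] := adm i (ltnW imu).
  rewrite redE_S; apply: rank_reduced_pair (Yb t It) _ dimN.
  exact: (redC_basis adm (ltnW imu) It).
have {}rS k : (k < mu)%N -> (r k)%:Z = (r 0%N)%:Z - \sum_(j < k) (theta j)%:Z.
  elim: k => [|k IHk] kmu; first by rewrite big_ord0 subr0.
  rewrite big_ord_recr/= opprD addrA -IHk ?(ltnW kmu)// -(rS k kmu).
  by rewrite PoszD addrK.
by apply: rS; case: mu mu0 {adm pre Emu rmu uE ScanE basisS}.
Qed.
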